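(* There exists an absolute constant $c>0$ so that for any $p=p(n)$ satisfying $\frac{2}{n}\le p\le c$ and for $G=G(n,p)$, $$\tau(G)=n-\Theta\left(\frac{\log(np)}{p}\right)$$ whp. That is, there are absolute constants $c,C_1,C_2>0$ such that for every function $p=p(n)$ with $\frac{2}{n}\le p\le c$, the probability that $G=G(n,p)$ satisfies $$n-C_2\frac{\log(np)}{p}\le \tau(G)\le n-C_1\frac{\log(np)}{p}$$ tends to $1$ as $n\to\infty$.
   Context: $G(n,p)$ is the random graph on $n$ labeled vertices in which each pair of vertices is an edge independently with probability $p$. ''Whp'' means with probability tending to $1$ as $n$ tends to infinity. For a graph $G$, $\tau(G)$ is the minimum number of pairwise edge disjoint complete bipartite subgraphs of $G$ (not necessarily induced) such that each edge of $G$ belongs to exactly one of them. Logarithms are in base $2$. *)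

(* Defs.v *)
From mathcomp Require Import all_boot all_order all_algebra.
From mathcomp Require Import reals exp.

Set Implicit Arguments.
Unset Strict Implicit.
Unset Printing Implicit Defensive.

Import Order.TTheory GRing.Theory Num.Theory.

Local Open Scope ring_scope.

Definition pairs (T : finType) : {set {set T}} := [set e : {set T} | #|e| == 2%N].

(* A simple graph on T is given by its edge set, each edge being a 2-set. *)
Definition sgraph (T : finType) := {E : {set {set T}} | E \subset pairs T}.

Definition edges (T : finType) (G : sgraph T) : {set {set T}} := val G.

Definition complete_bipartite_edges (T : finType) (A B : {set T}) : {set {set T}} :=
  [set [set a; b] | a in A, b in B].

(* A complete bipartite subgraph is represented by its set of edges. *)
Definition biclique (T : finType) (F : {set {set T}}) : bool :=
  [exists A : {set T}, exists B : {set T},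
    [&& A != set0, B != set0, [disjoint A & B]
      & F == complete_bipartite_edges A B]].

Definition biclique_partition (T : finType) (G : sgraph T)
    (P : {set {set {set T}}}) : bool :=
  partition P (edges G) && [forall F in P, biclique F].

Definition single_edges (T : finType) (G : sgraph T) : {set {set {set T}}} :=
  [set [set e] | e in edges G].

(* The starting point single_edges is only there because arg min needs a
   witness that the minimum is over a nonempty set. *)
Definition tau (T : finType) (G : sgraph T) : nat :=
  #|[arg min_(P < single_edges G | biclique_partition G P) #|P| ]|.

Lemma single_edgesP (T : finType) (G : sgraph T) :
  biclique_partition G (single_edges G).
Proof.
apply/andP; split.
- apply/and3P; split.
  + apply/eqP/setP => e; apply/bigcupP/idP => [[F /imsetP[e' e'G ->]]|eG].
      by rewrite inE => /eqP ->.
    by exists [set e]; [apply: imset_f | rewrite inE].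
  + apply/trivIsetP => F1 F2 /imsetP[e1 _ ->] /imsetP[e2 _ ->] ne.
    rewrite disjoints1 inE; apply: contraNneq ne => ->; exact: eqxx.
  + apply/imsetP => -[e _ /setP/(_ e)]; by rewrite !inE eqxx.
- apply/forall_inP => _ /imsetP[e eG ->].
  have : e \in pairs T by exact: (subsetP (valP G)).
  rewrite /pairs inE => /cards2P[x [y [nxy ->]]].
  apply/existsP; exists [set x]; apply/existsP; exists [set y].
  apply/and4P; split; first by apply/set0Pn; exists x; rewrite inE.
  + by apply/set0Pn; exists y; rewrite inE.
  + by rewrite disjoints1 inE.
  + apply/eqP/setP => f; apply/idP/imset2P => [|[a b]].
      by rewrite inE => /eqP ->; exists x y; rewrite ?inE.
    by rewrite !inE => /eqP -> /eqP -> ->.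
Qed.

Lemma tau_attained (T : finType) (G : sgraph T) :
  exists2 P, biclique_partition G P & #|P| = tau G.
Proof.
rewrite /tau; case: arg_minnP; first exact: single_edgesP.
by move=> P hP _; exists P.
Qed.

Lemma tau_le (T : finType) (G : sgraph T) (P : {set {set {set T}}}) :
  biclique_partition G P -> (tau G <= #|P|)%N.
Proof.
rewrite /tau; case: arg_minnP; first exact: single_edgesP.
by move=> Q _ minQ; exact: minQ.
Qed.

(* Law of G(n, p): each pair is present, independently, with probability p. *)
Definition Gnp_weight (R : realType) (n : nat) (p : R) (G : sgraph 'I_n) : R :=
  \prod_(e in pairs 'I_n) (if e \in edges G then p else 1 - p).

Definition Gnp_prob (R : realType) (n : nat) (p : R) (A : pred (sgraph 'I_n)) : R :=
  \sum_(G : sgraph 'I_n | A G) Gnp_weight p G.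

Lemma Gnp_prob_total (R : realType) (n : nat) (p : R) :
  Gnp_prob p (fun _ : sgraph 'I_n => true) = 1.
Proof.
pose f e : R := if e \in pairs 'I_n then p else 0.
pose g e : R := if e \in pairs 'I_n then 1 - p else 1.
have <- : \prod_(e : {set 'I_n}) (f e + g e) = 1.
  by apply: big1 => e _; rewrite /f /g; case: ifP => _; rewrite ?add0r// addrC subrK.
rewrite bigA_distr (bigID (fun J : {set {set 'I_n}} => J \subset pairs 'I_n)) /=.
rewrite [X in _ + X]big1 ?addr0; last first.
  move=> J /subsetPn[e eJ /negbTE eN].
  by rewrite (bigD1 e) //= eJ /f eN mul0r.
pose G0 : sgraph 'I_n := Sub set0 (sub0set _).
rewrite /Gnp_prob (reindex_onto (@edges _) (insubd G0)); last first.
  by move=> J JP; rewrite /edges insubdK.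
apply: eq_big => [G|G _]; first by rewrite /edges (valP G) valKd eqxx.
rewrite /Gnp_weight big_mkcond; apply: eq_bigr => e _; rewrite /f /g.
case: ifPn => // eN; case: ifPn => // eG.
by rewrite (subsetP (valP G) _ eG) in eN.
Qed.

Definition log2 (R : realType) (x : R) : R := ln x / ln 2.

(* Main.v *)
Require Import Defs.
From mathcomp Require Import all_boot all_order all_algebra.
From mathcomp Require Import reals sequences exp.
From mathcomp Require Import ring lra zify.

(** Write d = n p and u0 = C2 log2(d) / p.

Upper bound on tau.  If I is an independent set, the edges split into stars
centred at the vertices outside I, so tau is at most n - #|I|
([tau_le_independent]).  It remains to see that G(n, p) has an independent set
of size K of order ln(d) / p.  If it has none, a maximal independent set I has
fewer than K vertices, and every vertex outside I has a neighbour in I, an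
event of probability (1 - (1 - p)^#|I|)^(n - #|I|)
([Gnp_prob_dominating]).  For a small enough constant in K, (1 - p)^K exceeds
d^(-1/4), and this probability, at most exp (- n d^(-1/4) / 2), beats the
number of sets with fewer than K vertices ([prob_tau_large]).

Lower bound on tau.  Take an optimal partition and delete the centre of a star
from the vertex set as long as some part is a star; each deletion destroys at
least one part.  What is left is a set U of vertices and a partition of the
edges inside U into thick bicliques, whose two sides both have at least two
vertices, and n - #|U| + #|parts| <= tau ([remove_stars]).  If tau < n - u0
then #|U| > u0, and there are at most #|U| parts.  A union bound over U shows
that this is unlikely, as soon as a given U has this property with probability
at most d^(-#|U|) ([prob_thick_le]).

To see the latter, put u = #|U|, q = sqrt p and p = exp (- l).  By a Chernoff
bound U spans at least r = p 'C(u, 2) / 4 edges.  The expected number of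
families of at most u edge-disjoint thick bicliques covering at least r edges
is at most the sum of p^(number of edges), hence at most exp (- l r / 2) times
the sum of the products of the q^#|f|, over all families of at most u thick
bicliques f.  That sum is at most mu^u e as soon as mu bounds the total weight
of the single thick bicliques ([family_weight_le], [prob_thick_decomposable]).
For the single bicliques with sides 2 <= a <= b one uses q^(a b) <= p^b if
a <= 2 k, and q^(a b) <= q^(k (a + b)) if a > 2 k.  With k just large enough
for q^k <= 1 / u, the total weight is at most exp (3 + 2 k ln u + p u)
([thick_weight_le_expR]).  The exponent l r / (2 u) is of order l p u, that is,
p u times log (1 / p).  When p u is at least a large constant times
max (1, ln d), and p is below a small constant, this dominates
p u + 2 k ln u + ln d ([exponent_arith]). *)

Set Implicit Arguments.
Unset Strict Implicit.
Unset Printing Implicit Defensive.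

Import Order.TTheory GRing.Theory Num.Theory.

Local Open Scope ring_scope.

(** * Sums over subsets *)

Lemma prod_add1_subsets (S : comNzRingType) (I : finType) (X : {set I}) (y : I -> S) :
  \prod_(i in X) (1 + y i) = \sum_(J : {set I} | J \subset X) \prod_(i in J) y i.
Proof.
pose f i : S := if i \in X then y i else 0.
have -> : \prod_(i in X) (1 + y i) = \prod_i (f i + 1).
  rewrite big_mkcond; apply: eq_bigr => i _; rewrite /f.
  by case: ifP => _; rewrite ?add0r // addrC.
rewrite bigA_distr (bigID (fun J : {set I} => J \subset X)) /=.
rewrite [X in _ + X]big1 ?addr0; last first.
  by move=> J /subsetPn[i iJ /negbTE iX]; rewrite (bigD1 i) //= iJ /f iX mul0r.
apply: eq_bigr => J JX; rewrite [RHS]big_mkcond; apply: eq_bigr => i _.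
by case: ifPn => // iJ; rewrite /f (subsetP JX).
Qed.

Lemma sum_subsets_exp (S : comNzRingType) (I : finType) (X : {set I}) (x : S) :
  \sum_(J : {set I} | J \subset X) x ^+ #|J| = (1 + x) ^+ #|X|.
Proof.
rewrite -prodr_const prod_add1_subsets.
by apply: eq_bigr => J _; rewrite prodr_const.
Qed.

Lemma le_expr (R : realType) (m : nat) (a b : R) :
  0 <= a -> a <= b -> a ^+ m <= b ^+ m.
Proof. by move=> a0 ab; rewrite lerXn2r // nnegrE // (le_trans a0). Qed.

(** * Probabilities of events in G(n, p) *)

Section Expectation.
Variables (R : realType) (n : nat).
Implicit Types (p : R) (G : sgraph 'I_n) (D : {set {set 'I_n}}).

Lemma sum_sgraph_prod (x y : {set 'I_n} -> R) :
  \sum_(G : sgraph 'I_n) \prod_(e in pairs 'I_n) (if e \in edges G then x e else y e)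
  = \prod_(e in pairs 'I_n) (x e + y e).
Proof.
pose f e : R := if e \in pairs 'I_n then x e else 0.
pose g e : R := if e \in pairs 'I_n then y e else 1.
have -> : \prod_(e in pairs 'I_n) (x e + y e) = \prod_e (f e + g e).
  rewrite big_mkcond; apply: eq_bigr => e _; rewrite /f /g.
  by case: ifP => _; rewrite ?add0r.
rewrite bigA_distr (bigID (fun J : {set {set 'I_n}} => J \subset pairs 'I_n)) /=.
rewrite [X in _ + X]big1 ?addr0; last first.
  by move=> J /subsetPn[e eJ /negbTE eN]; rewrite (bigD1 e) //= eJ /f eN mul0r.
rewrite (reindex_onto (@edges _) (insubd (Sub set0 (sub0set _) : sgraph _))); last first.
  by move=> J JP; rewrite /edges insubdK.
apply: eq_big => [G|G _]; first by rewrite /edges (valP G) valKd eqxx.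
rewrite big_mkcond; apply: eq_bigr => e _; rewrite /f /g.
case: ifPn => // eN; case: ifPn => // eG.
by rewrite (subsetP (valP G) _ eG) in eN.
Qed.

(** Independence of the pairs, in the form in which it is used below: the
    expectation of a product over pairs is the product of the expectations. *)
Lemma Gnp_expect_prod p D (x y : R) : D \subset pairs 'I_n ->
  \sum_(G : sgraph 'I_n)
     Gnp_weight p G * \prod_(e in D) (if e \in edges G then x else y)
  = (p * x + (1 - p) * y) ^+ #|D|.
Proof.
move=> DP; pose f z e : R := if e \in D then z else 1.
have -> : (p * x + (1 - p) * y) ^+ #|D|
    = \prod_(e in pairs 'I_n) (p * f x e + (1 - p) * f y e).
  rewrite -prodr_const big_mkcond [RHS]big_mkcond; apply: eq_bigr => e _.
  rewrite /f; case: ifPn => eD; first by rewrite (subsetP DP).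
  by case: ifP => //; rewrite !mulr1 subrKC.
rewrite -sum_sgraph_prod; apply: eq_bigr => G _.
have -> : \prod_(e in D) (if e \in edges G then x else y)
    = \prod_(e in pairs 'I_n) (if e \in edges G then f x e else f y e).
  rewrite big_mkcond [RHS]big_mkcond; apply: eq_bigr => e _.
  rewrite /f; case: ifPn => eD; first by rewrite (subsetP DP).
  by rewrite !if_same.
by rewrite -big_split; apply: eq_bigr => e _ /=; case: ifP.
Qed.

Lemma prod_forall (I : finType) (X : {pred I}) (P : pred I) :
  \prod_(i in X) (if P i then 1 else 0) = (if [forall i in X, P i] then 1 else 0) :> R.
Proof.
case: ifPn => [/forall_inP XP|/forall_inPn[i iX /negbTE Pi]].
  by apply: big1 => i iX; rewrite XP.
by rewrite (bigD1 i) //= Pi mul0r.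
Qed.

Lemma Gnp_probE p (A : pred (sgraph 'I_n)) :
  Gnp_prob p A = \sum_(G : sgraph 'I_n) Gnp_weight p G * (if A G then 1 else 0).
Proof.
rewrite /Gnp_prob big_mkcond; apply: eq_bigr => G _.
by case: ifP; rewrite ?mulr1 ?mulr0.
Qed.

Lemma Gnp_prob_superset p D : D \subset pairs 'I_n ->
  Gnp_prob p (fun G => D \subset edges G) = p ^+ #|D|.
Proof.
move=> DP; rewrite -[p]mulr1 -[in RHS](addr0 (p * 1)) -[0](mulr0 (1 - p)).
rewrite -Gnp_expect_prod // mulr1 Gnp_probE; apply: eq_bigr => G _.
have -> : (D \subset edges G) = [forall e in D, e \in edges G].
  by apply/subsetP/forall_inP.
by rewrite -prod_forall.
Qed.

Lemma Gnp_prob_disjoint p D : D \subset pairs 'I_n ->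
  Gnp_prob p (fun G => [disjoint D & edges G]) = (1 - p) ^+ #|D|.
Proof.
move=> DP; rewrite -[1 - p]mulr1 -[in RHS](add0r ((1 - p) * 1)) -[0](mulr0 p).
rewrite -Gnp_expect_prod // Gnp_probE; apply: eq_bigr => G _; congr (_ * _).
transitivity (\prod_(e in D) (if e \notin edges G then 1 else 0 : R)).
  rewrite prod_forall; have -> // : [disjoint D & edges G] = [forall e in D, e \notin edges G].
  by rewrite disjoint_subset; apply/subsetP/forall_inP.
by apply: eq_bigr => e _; case: (e \in edges G).
Qed.

Section Bounds.
Variable p : R.
Hypothesis p01 : 0 <= p <= 1.

Lemma Gnp_weight_ge0 G : 0 <= Gnp_weight p G.
Proof. by have [p0 p1] := andP p01; apply: prodr_ge0 => e _; case: ifP; lra. Qed.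

Lemma le_Gnp_prob (A B : pred (sgraph 'I_n)) :
  (forall G, A G -> B G) -> Gnp_prob p A <= Gnp_prob p B.
Proof.
move=> AB; rewrite !Gnp_probE; apply: ler_sum => G _.
by rewrite ler_wpM2l ?Gnp_weight_ge0 //; case: (boolP (A G)) => [/AB ->|_] //; case: ifP.
Qed.

Lemma Gnp_prob_union (J : finType) (Q : pred J) (A : pred (sgraph 'I_n))
    (B : J -> pred (sgraph 'I_n)) :
  (forall G, A G -> exists2 j, Q j & B j G) ->
  Gnp_prob p A <= \sum_(j | Q j) Gnp_prob p (B j).
Proof.
move=> AB; under eq_bigr do rewrite Gnp_probE.
rewrite exchange_big Gnp_probE /=; apply: ler_sum => G _.
rewrite -mulr_sumr ler_wpM2l ?Gnp_weight_ge0 //.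
have b0 j : 0 <= (if B j G then 1 else 0) :> R by case: ifP.
case: ifPn => [/AB[j Qj BjG]|_]; last by rewrite sumr_ge0.
by rewrite (bigD1 j) //= BjG lerDl sumr_ge0.
Qed.

Lemma Gnp_prob_cup (A B C : pred (sgraph 'I_n)) :
  (forall G, A G -> B G || C G) -> Gnp_prob p A <= Gnp_prob p B + Gnp_prob p C.
Proof.
move=> ABC; rewrite !Gnp_probE -big_split /=.
apply: ler_sum => G _; rewrite -mulrDr ler_wpM2l ?Gnp_weight_ge0 //.
by have := ABC G; case: (A G); case: (B G); case: (C G) => //= h; (lra || by have := h isT).
Qed.

Lemma Gnp_prob_compl (A : pred (sgraph 'I_n)) :
  Gnp_prob p A = 1 - Gnp_prob p (fun G => ~~ A G).
Proof.
rewrite -(Gnp_prob_total n p) !Gnp_probE -sumrB; apply: eq_bigr => G _.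
by rewrite -mulrBr; case: (A G); rewrite ?subr0 ?subrr.
Qed.

(** Chernoff bound for the lower tail: Markov's inequality for 2^(- X), where
    X counts the edges in D; its expectation is (1 - p / 2)^#|D|. *)
Lemma Gnp_prob_few_edges D : D \subset pairs 'I_n ->
  Gnp_prob p (fun G => #|D :&: edges G|%:R <= p * #|D|%:R / 4)
    <= expR (- (p * #|D|%:R / 4)).
Proof.
move=> DP; have [p0 p1] := andP p01; set r := p * _ / 4.
have half0 : 0 <= 1 + - (p / 2) by lra.
have halfE : p * 2^-1 + (1 - p) * 1 = 1 + - (p / 2) by field.
have rE : - r = r + - (2 * r) by ring.
have e2 : expR (- 1) <= 2^-1 :> R.
  by rewrite expRN lef_pV2 ?posrE ?expR_gt0 //; have := expR_ge1Dx (1 : R); lra.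
have := Gnp_expect_prod p 2^-1 1 DP; rewrite halfE.
move=> EQ; have : (1 + - (p / 2)) ^+ #|D| <= expR (- (2 * r)).
  rewrite [leRHS](_ : _ = expR (- (p / 2)) ^+ #|D|); last first.
    by rewrite -expRM_natl /r; congr expR; field.
  by apply: le_expr; [|exact: expR_ge1Dx].
rewrite -EQ => {}EQ; rewrite rE expRD; apply: (le_trans _ (ler_wpM2l (expR_ge0 _) EQ)).
rewrite Gnp_probE mulr_sumr; apply: ler_sum => G _.
rewrite mulrCA ler_wpM2l ?Gnp_weight_ge0 //.
have -> : \prod_(e in D) (if e \in edges G then 2^-1 else 1) = (2 : R)^-1 ^+ #|D :&: edges G|.
  rewrite -prodr_const big_mkcond [RHS]big_mkcond; apply: eq_bigr => e _.
  by rewrite inE; case: (e \in D) => //=; rewrite mulr1.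
case: ifPn => [small|_]; last by rewrite mulr_ge0 ?expR_ge0 ?exprn_ge0 ?invr_ge0.
apply: (@le_trans _ _ (expR r * expR (- 1) ^+ #|D :&: edges G|)); last first.
  by apply: ler_wpM2l; [exact: expR_ge0|apply: le_expr; rewrite ?expR_ge0].
rewrite -expRM_natl -expRD -[X in X <= _]expR0 ler_expR.
by move: small; clear; lra.
Qed.

End Bounds.
End Expectation.

(** * Bicliques and independent sets *)

Section Bicliques.
Local Open Scope nat_scope.
Variable T : finType.
Implicit Types (A B U I : {set T}) (f : {set {set T}}) (G : sgraph T).
Local Notation cbe := complete_bipartite_edges.

Lemma complete_bipartite_edgesC A B : cbe A B = cbe B A.
Proof.
by apply/setP => e; apply/imset2P/imset2P => -[a b aA bB ->]; exists b a; rewrite // setUC.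
Qed.

Lemma card_complete_bipartite_edges A B :
  [disjoint A & B] -> #|cbe A B| = #|A| * #|B|.
Proof.
move=> dAB; have -> : cbe A B = [set [set x.1; x.2] | x in setX A B].
  apply/setP => e; apply/imset2P/imsetP => [[a b aA bB ->]|[[a b]]].
    by exists (a, b); rewrite // inE aA.
  by rewrite inE => /andP[aA bB] ->; exists a b.
rewrite card_in_imset ?cardsX //.
move=> [a b] [a' b']; rewrite !inE /= => /andP[aA bB] /andP[a'A b'B] eq2.
have ne x y : x \in A -> y \in B -> x != y.
  by move=> xA yB; apply: contraTneq yB => <-; rewrite (disjointFr dAB).
have /setP/(_ a) := eq2; have /setP/(_ b) := eq2; rewrite !inE.
rewrite !eqxx orbT /= (negPf (ne _ _ aA b'B)) orbF.
rewrite [b == a']eq_sym (negPf (ne _ _ a'A bB)) /=.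
by move=> /esym/eqP -> /esym/eqP ->.
Qed.

Lemma complete_bipartite_edges_pairs A B :
  [disjoint A & B] -> cbe A B \subset pairs T.
Proof.
move=> dAB; apply/subsetP => _ /imset2P[a b aA bB ->].
rewrite inE cards2; case: (eqVneq a b) => // ab.
by rewrite ab in aA; rewrite (disjointFr dAB aA) in bB.
Qed.

Lemma edge_pair G e v : e \in edges G -> v \in e -> exists2 w, w != v & e = [set v; w].
Proof.
move=> /(subsetP (valP G)); rewrite inE => /cards2P[x [y [nxy ->]]].
rewrite !inE => /orP[]/eqP ->; first by exists y; rewrite // eq_sym.
by exists x; rewrite // setUC.
Qed.

Definition independent G I := [forall e in edges G, ~~ (e \subset I)].

Definition dominating G I :=
  [forall v in ~: I, ~~ [disjoint cbe [set v] I & edges G]].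

(** Attach each edge to one of its endpoints outside I; the edges attached to a
    given vertex form a star. *)
Lemma tau_le_independent G I : independent G I -> tau G <= #|~: I|.
Proof.
move=> /forall_inP indI.
pose f (e : {set T}) := [pick v in e :\: I].
have fE e : e \in edges G -> exists2 v, v \in e :\: I & f e = Some v.
  move=> eG; rewrite /f; case: pickP => [v ve|e0]; first by exists v.
  by case/subsetPn: (indI e eG) => v ve vI; have := e0 v; rewrite inE vI ve.
pose P := preim_partition f (edges G).
have PE : P = [set [set e in edges G | o == f e] | o in f @: edges G].
  by rewrite -imset_comp.
apply: (@leq_trans #|P|); last first.
  rewrite PE; apply: (leq_trans (leq_imset_card _ _)).
  have Some_inj : injective (@Some T) by move=> x y [].
  rewrite -(card_imset _ Some_inj); apply/subset_leq_card/subsetP => o /imsetP[e eG ->].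
  by have [v /[!inE]/andP[vI _] ->] := fE e eG; apply: imset_f; rewrite inE.
apply: tau_le; rewrite /biclique_partition preim_partitionP PE /=.
apply/forall_inP => _ /imsetP[o /imsetP[e eG ->] ->].
have [v /[!inE]/andP[vI ve] fe] := fE e eG.
set X := [set _ in _ | _].
have Xv e' : e' \in X -> v \in e'.
  by rewrite inE fe => /andP[/fE[w /[!inE]/andP[_ we] ->] /eqP[->]].
have [w wv eE] := edge_pair eG ve.
pose B := [set w' | ([set v; w'] \in X) && (w' != v)].
have eX : e \in X by rewrite inE eG eqxx.
apply/existsP; exists [set v]; apply/existsP; exists B; apply/and4P; split.
- by apply/set0Pn; exists v; rewrite inE.
- by apply/set0Pn; exists w; rewrite inE -eE eX.
- by rewrite disjoints1 inE eqxx andbF.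
- apply/eqP/setP => e'; apply/idP/imset2P => [e'X|[v' w' /[!inE]/eqP-> /andP[w'X _] ->]].
    have e'G : e' \in edges G by move: e'X; rewrite inE => /andP[].
    have [w' w'v e'E] := edge_pair e'G (Xv _ e'X).
    by exists v w'; rewrite ?set11 // inE -e'E e'X.
  by [].
Qed.

(** A maximal independent set is dominating. *)
Lemma exists_independent_dominating G : exists I, independent G I && dominating G I.
Proof.
have ind0 : independent G set0.
  apply/forall_inP => e /(subsetP (valP G)); rewrite inE subset0 => /eqP e2.
  by apply: contraTneq isT => e0; rewrite e0 cards0 in e2.
have [I /maxsetP[indI maxI] _] := maxset_exists ind0.
exists I; rewrite indI; apply/forall_inP => v; rewrite inE => vI.
have : ~~ independent G (v |: I).
  by apply: contra vI => /maxI/(_ (subsetUr _ _)) <-; rewrite setU11.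
case/forall_inPn => e eG /negPn evI.
have ve : v \in e.
  apply: contraLR (forall_inP indI e eG) => ve; apply/negPn/subsetP => x xe.
  have := subsetP evI x xe; rewrite !inE => /orP[/eqP xv|//].
  by rewrite xv (negPf ve) in xe.
have [w wv eE] := edge_pair eG ve.
apply/pred0Pn; exists e; rewrite /= eG andbT eE; apply: imset2_f; rewrite ?inE //.
by have := subsetP evI w; rewrite eE !inE eqxx orbT (negPf wv); apply.
Qed.

Definition induced_edges G U := [set e in edges G | e \subset U].

(** The bicliques that are not stars. The smaller side comes first, which costs
    nothing since the two sides can be exchanged, and spares the counting of
    pairs of sides a case distinction. *)
Definition thick_biclique U f :=
  [exists A : {set T}, exists B : {set T},
    [&& A :|: B \subset U, 1 < #|A|, #|A| <= #|B|, [disjoint A & B] & f == cbe A B]].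

Definition delete_vertex v f : {set {set T}} := [set e in f | v \notin e].

Lemma delete_vertex_biclique v A B : delete_vertex v (cbe A B) = cbe (A :\ v) (B :\ v).
Proof.
apply/setP => e; rewrite inE; apply/andP/imset2P => [[/imset2P[a b aA bB ->]]|[a b]].
  rewrite !inE negb_or => /andP[va vb].
  by exists a b; rewrite // !inE 1?eq_sym ?va ?vb.
rewrite !inE => /andP[av aA] /andP[bv bB] ->; split; first exact: imset2_f.
by rewrite !inE negb_or ![v == _]eq_sym av.
Qed.

(** Deleting the centre of a star from U empties that star and restricts the
    other bicliques to bicliques, possibly empty or new stars, so that
    #|F| + #|~: U| does not increase. Iterate until no star is left. *)
Lemma remove_stars G U (F : {set {set {set T}}}) :
  trivIset F -> cover F = induced_edges G U -> {in F, forall f, biclique f} ->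
  exists U' F', [/\ trivIset F', cover F' = induced_edges G U',
    {in F', forall f, thick_biclique U' f} & #|F'| + #|~: U'| <= #|F| + #|~: U|].
Proof.
have [m] := ubnP #|U|; elim: m => // m IHm in U F * => leUm tF cF bF.
have [allthick|] := boolP [forall f in F, thick_biclique U f].
  by exists U, F; split=> // f; apply/forall_inP.
case/forall_inPn => f0 f0F thin.
have [v vU vf0] : exists2 v, v \in U & (forall e, e \in f0 -> v \in e).
  have /existsP[A /existsP[B /and4P[A0 B0 dAB /eqP f0E]]] := bF _ f0F.
  have f0U a b : a \in A -> b \in B -> (a \in U) && (b \in U).
    move=> aA bB; have : [set a; b] \in cover F.
      by apply/bigcupP; exists f0; rewrite // f0E; apply: imset2_f.
    by rewrite cF inE => /andP[_]; rewrite subUset !sub1set.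
  have [[a aA] [b bB]] := (set0Pn _ A0, set0Pn _ B0).
  have AU : A \subset U by apply/subsetP => x xA; case/andP: (f0U x b xA bB).
  have BU : B \subset U by apply/subsetP => x xB; case/andP: (f0U a x aA xB).
  have A1 : 0 < #|A| by rewrite card_gt0.
  have B1 : 0 < #|B| by rewrite card_gt0.
  have thin2 : (#|A| == 1) || (#|B| == 1).
    apply: contraR thin; rewrite negb_or => /andP[A2 B2].
    case/orP: (leq_total #|A| #|B|) => leAB; apply/existsP.
      exists A; apply/existsP; exists B; rewrite subUset AU BU leAB dAB f0E eqxx.
      by rewrite ltn_neqAle eq_sym A2 A1.
    exists B; apply/existsP; exists A; rewrite subUset AU BU leAB disjoint_sym dAB f0E.
    by rewrite ltn_neqAle eq_sym B2 B1 complete_bipartite_edgesC eqxx.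
  case/orP: thin2 => /cards1P[v vE].
    exists v; first by rewrite (subsetP AU) // vE inE.
    by move=> e; rewrite f0E vE => /imset2P[x y /[!inE]/eqP-> _ ->]; rewrite !inE eqxx.
  exists v; first by rewrite (subsetP BU) // vE inE.
  by move=> e; rewrite f0E vE => /imset2P[x y _ /[!inE]/eqP-> ->]; rewrite !inE eqxx orbT.
pose F' := (delete_vertex v @: F) :\ set0.
have [|||| U' [F'' [tF'' cF'' bF'' leF'']]] := IHm (U :\ v) F'.
- by move: leUm; rewrite (cardsD1 v U) vU.
- apply/trivIsetP => _ _ /setD1P[_ /imsetP[f1 f1F ->]] /setD1P[_ /imsetP[f2 f2F ->]] ne.
  have ne12 : f1 != f2 by apply: contraNneq ne => ->.
  apply/pred0P => e /=; rewrite !inE; apply/negbTE/negP => /andP[/andP[e1 _] /andP[e2 _]].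
  by have /pred0P/(_ e) := trivIsetP tF _ _ f1F f2F ne12; rewrite /= e1 e2.
- apply/setP => e; rewrite inE; apply/bigcupP/andP => [[f /setD1P[_ /imsetP[g gF ->]]]|].
    rewrite inE => /andP[eg ve]; have : e \in cover F by apply/bigcupP; exists g.
    by rewrite cF inE => /andP[eG eU]; split; rewrite // subsetD1 eU.
  rewrite subsetD1 => -[eG /andP[eU ve]].
  have : e \in cover F by rewrite cF inE eG.
  case/bigcupP => f fF ef; have e' : e \in delete_vertex v f by rewrite inE ef.
  exists (delete_vertex v f) => //; rewrite !inE imset_f // andbT.
  by apply/set0Pn; exists e.
- move=> g /setD1P[g0 /imsetP[f fF gE]]; rewrite gE in g0 *; move: g0.
  have /existsP[A /existsP[B /and4P[A0 B0 dAB /eqP fAB]]] := bF _ fF.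
  rewrite fAB delete_vertex_biclique => /set0Pn[_ /imset2P[a b aA bB _]].
  apply/existsP; exists (A :\ v); apply/existsP; exists (B :\ v); apply/and4P; split=> //.
  + by apply/set0Pn; exists a.
  + by apply/set0Pn; exists b.
  + by apply: disjointWl (subsetDl _ _) _; apply: disjointWr (subsetDl _ _) _.
exists U', F''; split=> //; apply: (leq_trans leF'').
have -> : ~: (U :\ v) = v |: ~: U by apply/setP => x; rewrite !inE negb_and negbK.
rewrite cardsU1 inE vU /= addnCA addnA leq_add2r add1n.
have : F' \subset delete_vertex v @: (F :\ f0).
  apply/subsetP => g' /setD1P[g0 /imsetP[g gF gE]]; rewrite gE in g0 *; apply: imset_f.
  rewrite !inE gF andbT; apply: contraNneq g0 => ->.
  by apply/eqP/setP => e; rewrite !inE; apply/negbTE/negP => /andP[/vf0 ->].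
move=> /subset_leq_card/leq_trans/(_ (leq_imset_card _ _)).
by rewrite [#|F|](cardsD1 f0) f0F add1n ltnS.
Qed.
End Bicliques.

(** * Weights of families of bicliques *)

(** Rankin's trick: as mu >= 1, a family F of at most m elements has weight at
    most mu^m times the product of the y i / mu; without the restriction on the
    size, the sum of these products is the product of the 1 + y i / mu. *)
Lemma family_weight_le (R : realType) (I : finType) (X : {set I}) (y : I -> R) (mu : R) m :
  (forall i, 0 <= y i) -> 1 <= mu ->
  \sum_(F : {set I} | (F \subset X) && (#|F| <= m)%N) \prod_(i in F) y i
    <= mu ^+ m * expR ((\sum_(i in X) y i) / mu).
Proof.
move=> y0 mu1; have mu0 : 0 < mu by rewrite (lt_le_trans ltr01).
have ymu i : 0 <= y i / mu by rewrite divr_ge0 // ltW.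
apply: (@le_trans _ _ (mu ^+ m * \prod_(i in X) (1 + y i / mu))); last first.
  apply: ler_wpM2l; first by rewrite exprn_ge0 // ltW.
  rewrite mulr_suml expR_sum.
  by apply: ler_prod => i _; rewrite addr_ge0 //= expR_ge1Dx.
rewrite prod_add1_subsets mulr_sumr [leRHS](bigID (fun F : {set I} => (#|F| <= m)%N)) /=.
rewrite -[leLHS]addr0; apply: lerD; last first.
  apply: sumr_ge0 => F _; rewrite mulr_ge0 ?exprn_ge0 ?(ltW mu0) //.
  by apply: prodr_ge0.
apply: ler_sum => F /andP[_ leFm].
rewrite big_split /= prodr_const mulrCA ler_peMr ?prodr_ge0 //.
by rewrite -(subnK leFm) exprD -mulrA -exprMn divff ?gt_eqF // expr1n mulr1 exprn_ege1.
Qed.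

Section Union.
Variables (R : realType) (n : nat).
Implicit Types (p : R) (G : sgraph 'I_n) (U I : {set 'I_n}).
Local Notation cbe := complete_bipartite_edges.

(** The events that v has a neighbour in I, for v outside I, concern disjoint
    sets of pairs. Expanding the product of their indicators reduces their
    independence to [Gnp_prob_disjoint]. *)
Lemma Gnp_prob_dominating p I :
  Gnp_prob p (fun G => dominating G I) = (1 - (1 - p) ^+ #|I|) ^+ #|~: I|.
Proof.
rewrite -sum_subsets_exp Gnp_probE.
have indE G (S : {set 'I_n}) : \prod_(v in S) (- (if [disjoint cbe [set v] I & edges G] then 1 else 0))
    = (-1) ^+ #|S| * (if [disjoint cbe S I & edges G] then 1 else 0) :> R.
  rewrite prodrN prod_forall; congr (_ * _).
  suff -> : [forall v in S, [disjoint cbe [set v] I & edges G]] = [disjoint cbe S I & edges G] by [].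
  rewrite disjoint_subset; apply/forall_inP/subsetP => [H e|H v vS].
    move=> /imset2P[a b aS bI eE]; rewrite inE.
    by rewrite (disjointFr (H a aS)) // eE; apply: imset2_f; rewrite ?inE.
  rewrite disjoint_subset; apply/subsetP => _ /imset2P[a b /[!inE]/eqP-> bI ->].
  by have := H [set v; b]; rewrite !inE; apply; apply: imset2_f.
transitivity (\sum_(G : sgraph 'I_n) \sum_(S : {set 'I_n} | S \subset ~: I)
    Gnp_weight p G * ((-1) ^+ #|S| * (if [disjoint cbe S I & edges G] then 1 else 0))).
  apply: eq_bigr => G _; rewrite -mulr_sumr; congr (_ * _).
  rewrite -prod_forall; under [RHS]eq_bigr do rewrite -indE.
  rewrite -prod_add1_subsets; apply: eq_bigr => v _.
  by case: [disjoint _ & _] => /=; rewrite ?subrr ?subr0.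
rewrite exchange_big /=; apply: eq_bigr => S SI.
have dSI : [disjoint S & I].
  by rewrite disjoint_subset; apply: subset_trans SI _; apply/subsetP => x; rewrite !inE.
under eq_bigr do rewrite mulrCA.
rewrite -mulr_sumr -Gnp_probE Gnp_prob_disjoint ?complete_bipartite_edges_pairs //.
by rewrite card_complete_bipartite_edges // mulnC exprM [in RHS]exprNn.
Qed.

Definition thick_bicliques U := [set f : {set {set 'I_n}} | thick_biclique U f].

(** What [remove_stars] leaves when tau G < n - u0: see
    [thick_decomposable_of_tau]. *)
Definition thick_decomposable G U :=
  [exists F : {set {set {set 'I_n}}},
    [&& trivIset F, cover F == induced_edges G U,
        F \subset thick_bicliques U & (#|F| <= #|U|)%N]].

Definition thick_weight (q : R) U : R := \sum_(f in thick_bicliques U) q ^+ #|f|.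

(** The two terms bound the weight of the bicliques whose smaller side has at
    most, respectively more than, 2 k vertices. In the first term the number of
    sets A with at most 2 k vertices is bounded by the sum of the
    u^(2 k - #|A|), over all subsets A of U, with u = #|U|. *)
Lemma thick_weight_le (q : R) U k : (0 < #|U|)%N -> 0 <= q <= 1 ->
  thick_weight q U <=
    #|U|%:R ^+ (2 * k) * (1 + #|U|%:R^-1) ^+ #|U| * (1 + q ^+ 2) ^+ #|U|
    + (1 + q ^+ k) ^+ #|U| * (1 + q ^+ k) ^+ #|U|.
Proof.
move=> U0 /andP[q0 q1]; set u : R := #|U|%:R.
have u1 : 1 <= u by rewrite ler1n.
have u0 : u != 0 by rewrite gt_eqF // (lt_le_trans ltr01).
rewrite -mulrA -!sum_subsets_exp !big_distrlr mulr_sumr -big_split /=.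
under [leRHS]eq_bigr do rewrite mulr_sumr -big_split /=.
apply: (@le_trans _ _ (\sum_(A : {set 'I_n} | A \subset U) \sum_(B : {set 'I_n} | B \subset U)
   (if [&& 1 < #|A|, #|A| <= #|B| & [disjoint A & B]]%N then q ^+ #|cbe A B| else 0))).
  rewrite pair_big /=.
  (* A biclique may arise from several pairs of sides: its weight is bounded by
     the sum of the weights of all of them. *)
  pose h (ab : {set 'I_n} * {set 'I_n}) := cbe ab.1 ab.2.
  pose good (ab : {set 'I_n} * {set 'I_n}) :=
    [&& ab.1 \subset U, ab.2 \subset U, 1 < #|ab.1|, #|ab.1| <= #|ab.2|
      & [disjoint ab.1 & ab.2]]%N.
  have sub : thick_bicliques U \subset h @: [set ab | good ab].
    apply/subsetP => f; rewrite inE.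
    case/existsP=> A /existsP[B /and5P[]]; rewrite subUset => /andP[AU BU] A1 AB dAB /eqP ->.
    by apply/imsetP; exists (A, B); rewrite // inE /good /= AU BU A1 AB dAB.
  apply: (@le_trans _ _ (\sum_(f in h @: [set ab | good ab]) q ^+ #|f|)).
    rewrite [leRHS](bigID (fun f => f \in thick_bicliques U)) /=.
    rewrite -[leLHS]addr0 lerD ?sumr_ge0 // => [|f _]; last exact: exprn_ge0.
    rewrite [leRHS](eq_bigl (fun f => f \in thick_bicliques U)) //.
    by move=> f; rewrite andbC; case: (boolP (f \in thick_bicliques U)) => // /(subsetP sub) ->.
  apply: (@le_trans _ _ (\sum_(ab in [set ab | good ab]) q ^+ #|h ab|)).
    rewrite [leRHS](partition_big_imset h) /=; apply: ler_sum => _ /imsetP[ab abg ->].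
    rewrite (bigD1 ab) /=; last by rewrite abg eqxx.
    by rewrite lerDl sumr_ge0 // => *; apply: exprn_ge0.
  rewrite big_mkcond [leRHS]big_mkcond; apply: ler_sum => -[A B] _.
  rewrite inE /good /h /=.
  by case: (A \subset U); case: (B \subset U); case: ifP.
apply: ler_sum => A AU; apply: ler_sum => B BU; rewrite mulrA.
have rhs1 : 0 <= u ^+ (2 * k) * u^-1 ^+ #|A| * (q ^+ 2) ^+ #|B|.
  by rewrite !mulr_ge0 ?exprn_ge0 ?invr_ge0 ?ler0n.
have rhs2 : 0 <= (q ^+ k) ^+ #|A| * (q ^+ k) ^+ #|B| by rewrite !mulr_ge0 ?exprn_ge0.
case: ifP => [/and3P[A1 AB dAB]|_]; last by rewrite addr_ge0.
rewrite card_complete_bipartite_edges //.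
have [Ak|Ak] := leqP #|A| (2 * k).
  apply: ler_wpDr => //; apply: (@le_trans _ _ (1 * (q ^+ 2) ^+ #|B|)).
    by rewrite mul1r -exprM ler_wiXn2l // leq_mul2r A1 orbT.
  rewrite ler_wpM2r ?exprn_ge0 // -(subnK Ak) exprD -mulrA -exprMn divff // expr1n mulr1.
  exact: exprn_ege1.
apply: ler_wpDl => //; rewrite -!exprM -exprD ler_wiXn2l //.
rewrite -mulnDr (@leq_trans (k * (#|B| + #|B|))) ?leq_mul2l ?leq_add2r ?AB ?orbT //.
by rewrite addnn -mul2n mulnA [(k * 2)%N]mulnC leq_mul2r (ltnW Ak) orbT.
Qed.

(** Either U spans few edges, or the bicliques cover many pairs. In the latter
    case their weight p^(number of pairs) is q^(number of pairs), which is a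
    product over the family, times a factor that is uniformly small. *)
Lemma prob_thick_decomposable (l p q mu : R) U :
  0 <= l -> p = expR (- l) -> q = expR (- (l / 2)) -> 1 <= mu ->
  Gnp_prob p (fun G => thick_decomposable G U) <=
    expR (- (p * 'C(#|U|, 2)%:R / 4))
    + expR (- (l / 2 * (p * 'C(#|U|, 2)%:R / 4)))
      * (mu ^+ #|U| * expR (thick_weight q U / mu)).
Proof.
move=> l0 pE qE mu1.
have p01 : 0 <= p <= 1 by rewrite pE expR_ge0 expR_le1; lra.
have q0 : 0 <= q by rewrite qE expR_ge0.
have pq : p = q * q by rewrite pE qE -expRD; congr expR; field.
pose D := [set e in pairs 'I_n | e \subset U].
have DP : D \subset pairs 'I_n by apply/subsetP => e; rewrite inE => /andP[].
have cD : #|D| = 'C(#|U|, 2).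
  by rewrite -cards_draws; apply: eq_card => e; rewrite !inE andbC.
have indE G : induced_edges G U = D :&: edges G.
  apply/setP => e; rewrite 2!inE [in RHS]inE andbC.
  case: (boolP (e \in edges G)) => eG; rewrite ?andbF // !andbT.
  by rewrite (subsetP (valP G) e eG).
rewrite -cD; set r := p * _ / 4.
pose small G := #|D :&: edges G|%:R <= r.
pose big (F : {set {set {set 'I_n}}}) :=
  [&& F \subset thick_bicliques U, #|F| <= #|U|, trivIset F, cover F \subset pairs 'I_n
    & ~~ (#|cover F|%:R <= r)%R]%N.
have cases G : thick_decomposable G U ->
    small G \/ exists2 F, big F & cover F \subset edges G.
  case/existsP=> F /and4P[tF /eqP cF FU leF].
  case: (boolP (small G)) => [|rF]; [by left | right; exists F].
    rewrite /small -indE in rF.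
    rewrite /big FU leF tF cF rF indE andbT /=.
    by apply: subset_trans DP; apply: subsetIl.
  by rewrite cF indE subsetIr.
apply: (@le_trans _ _ (Gnp_prob p small + \sum_(F | big F) Gnp_prob p (fun G => cover F \subset edges G))).
  pose some_big G := [exists F, big F && (cover F \subset edges G)].
  apply: (@le_trans _ _ (Gnp_prob p small + Gnp_prob p some_big)).
    apply: Gnp_prob_cup => // G /cases[->//|[F bF FG]].
    by apply/orP; right; apply/existsP; exists F; rewrite bF.
  rewrite lerD2l; apply: Gnp_prob_union => // G /existsP[F /andP[bF FG]].
  by exists F.
apply: lerD; first exact: Gnp_prob_few_edges.
apply: le_trans (ler_wpM2l (expR_ge0 _) (@family_weight_le _ _ (thick_bicliques U) (fun f => q ^+ #|f|) mu #|U| _ mu1)).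
  rewrite mulr_sumr.
  apply: (@le_trans _ _ (\sum_(F | big F) expR (- (l / 2 * r)) * (\prod_(f in F) q ^+ #|f|))).
    apply: ler_sum => F /and5P[FU leF tF cF rF].
    rewrite Gnp_prob_superset // prodrXr (eqP tF) pq exprMn ler_wpM2r ?exprn_ge0 //.
    rewrite qE -expRM_natl ler_expR mulrN lerN2 mulrC ler_wpM2r ?divr_ge0 //.
    by rewrite ltW // ltNge.
  rewrite [leRHS](bigID big) /= -[leLHS]addr0; apply: lerD; last first.
    by apply: sumr_ge0 => F _; rewrite mulr_ge0 ?expR_ge0 ?prodr_ge0 // => *; apply: exprn_ge0.
  rewrite [leRHS](eq_bigl big) // => F; rewrite andbC.
  by apply: andb_idr => /and5P[-> ->].
by move=> f; apply: exprn_ge0.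
Qed.

End Union.

(** * A given set is unlikely to have a thick decomposition *)

Section Numeric.
Variable R : realType.
Implicit Types x y : R.

Lemma expR_ge_sqr x : 0 <= x -> (1 + x / 2) ^+ 2 <= expR x.
Proof.
move=> x0; rewrite [leRHS](_ : _ = expR (x / 2) ^+ 2); last first.
  by rewrite -expRM_natl; congr expR; field.
by apply: le_expr; [lra|exact: expR_ge1Dx].
Qed.

Lemma add1_expn_le x y m : 0 <= x -> m%:R * x <= y -> (1 + x) ^+ m <= expR y.
Proof.
move=> x0 mxy; apply: (@le_trans _ _ (expR x ^+ m)).
  by apply: le_expr; [lra|exact: expR_ge1Dx].
by rewrite -expRM_natl ler_expR.
Qed.

Lemma ln2_bounds : 2^-1 <= (ln 2 : R) <= 1.
Proof.
apply/andP; split.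
  rewrite -ler_expR lnK ?posrE // -[2^-1]opprK expRN -[leRHS]invrK lef_pV2 ?posrE ?expR_gt0 ?invr_gt0 //.
  by have := expR_ge1Dx (- 2^-1 : R); lra.
by rewrite -ler_expR lnK ?posrE //; have := expR_ge1Dx (1 : R); lra.
Qed.

(** The condition on k says that q^k <= 1 / u, where q = exp (- l / 2) and
    u = exp s = #|U|. *)
Lemma thick_weight_le_expR n (U : {set 'I_n}) (l s t : R) k : 
  0 <= l -> 0 <= s -> expR s = #|U|%:R -> t = expR (- l) * #|U|%:R ->
  2 * s <= k%:R * l ->
  thick_weight (expR (- (l / 2))) U <= expR (3 + (2 * k)%:R * s + t).
Proof.
move=> l0 s0 sE tE ks; set q := expR _.
have u0 : 0 < #|U|%:R :> R by rewrite -sE expR_gt0.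
have q01 : 0 <= q <= 1 by rewrite expR_ge0 expR_le1 oppr_le0 divr_ge0.
have t0 : 0 <= t by rewrite tE mulr_ge0 ?expR_ge0.
have qk0 : 0 <= q ^+ k by rewrite exprn_ge0 ?expR_ge0.
have b1 : (1 + #|U|%:R^-1) ^+ #|U| <= expR 1 :> R.
  by apply: add1_expn_le; rewrite ?invr_ge0 ?(ltW u0) // divff // gt_eqF.
have b2 : (1 + q ^+ 2) ^+ #|U| <= expR t.
  apply: add1_expn_le; first by rewrite exprn_ge0 ?expR_ge0.
  rewrite tE mulrC ler_wpM2r ?(ltW u0) // /q -expRM_natl le_eqVlt; apply/orP; left.
  by apply/eqP; congr expR; field.
have b3 : (1 + q ^+ k) ^+ #|U| <= expR 1.
  apply: add1_expn_le => //; rewrite -sE /q -expRM_natl -expRD -[leRHS]expR0 ler_expR.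
  by move: ks; clear; lra.
have kE : #|U|%:R ^+ (2 * k) = expR ((2 * k)%:R * s) by rewrite expRM_natl sE.
apply: le_trans (@thick_weight_le _ _ q U k _ q01) _; first by rewrite -(ltr0n R).
rewrite kE.
have c0 m (x : R) : 0 <= x -> 0 <= (1 + x) ^+ m by move=> x0; rewrite exprn_ge0 // addr_ge0.
have first_le : expR ((2 * k)%:R * s) * (1 + #|U|%:R^-1) ^+ #|U| * (1 + q ^+ 2) ^+ #|U|
    <= expR 1 * expR ((2 * k)%:R * s + t).
  rewrite expRD mulrCA mulrA; apply: ler_pM; rewrite ?mulr_ge0 ?expR_ge0 ?c0 ?invr_ge0 ?(ltW u0) //.
    by rewrite exprn_ge0 ?expR_ge0.
  by rewrite ler_wpM2l ?expR_ge0.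
have second_le : (1 + q ^+ k) ^+ #|U| * (1 + q ^+ k) ^+ #|U| <= expR 1 * expR 1.
  by apply: ler_pM; rewrite ?c0.
apply: le_trans (lerD first_le second_le) _.
have -> : 3 + (2 * k)%:R * s + t = 1 + (1 + (1 + ((2 * k)%:R * s + t))) by ring.
have := addr_ge0 (mulr_ge0 (ler0n R (2 * k)) s0) t0.
move: (_ + t) => X X0; rewrite !expRD -mulrDr ler_wpM2l ?expR_ge0 //.
have X1 : 1 <= expR X by rewrite -expR0 ler_expR.
have e2 : 2 <= expR 1 :> R by have := expR_ge1Dx (1 : R); lra.
move: X1 e2; move: (expR X) (expR 1) => a e a1 e2.
have h1 : a <= e * a by rewrite ler_peMl; lra.
have h2 : e <= e * a by rewrite ler_peMr; lra.
have h3 : 2 * (e * a) <= e * (e * a) by rewrite ler_wpM2r //; lra.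
lra.
Qed.

(** With t = p u and s = ln u, so that s - l = ln t. The term 2 k s is at most
    6 s^2 / l, where s^2 <= 2 l^2 + 8 t; hence it is at most 12 l + t, which is
    small compared to l t since t is large. *)
Lemma exponent_arith (l s t L k : R) :
  128 <= l -> 0 <= s - l -> (s - l) ^+ 2 <= 4 * t -> k * l <= 3 * s ->
  1024 <= t -> 1024 * L <= t ->
  4 + 2 * k * s + t + 2 * L <= l * t / 32.
Proof.
move=> l128 sl sl2 kl t1 tL.
have s0 : 0 <= s by lra.
have l0 : 0 < l by lra.
have ss : s ^+ 2 <= 2 * l ^+ 2 + 8 * t.
  have : 0 <= (s - 2 * l) ^+ 2 by apply: sqr_ge0.
  by move: sl2; rewrite !expr2; lra.
have ks : (2 * k * s) * l <= 6 * s ^+ 2.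
  by rewrite expr2; nra.
have lt : 128 * t <= l * t by nra.
have ks' : 2 * k * s <= 12 * l + t.
  rewrite -(ler_pM2r l0); apply: (le_trans ks); rewrite mulrDl.
  have : 48 * t <= t * l by lra.
  by move: ss; rewrite expr2; lra.
have : 1024 * l <= l * t by nra.
lra.
Qed.

(** Here L stands for ln (n p), so that the bound is (n p)^(- #|U|). *)
Lemma prob_thick_le n (U : {set 'I_n}) (l p L : R) :
  128 <= l -> p = expR (- l) -> 2^-1 <= L ->
  1024 <= p * #|U|%:R -> 1024 * L <= p * #|U|%:R ->
  Gnp_prob p (fun G => thick_decomposable G U) <= expR (- (#|U|%:R * L)).
Proof.
move=> l128 pE L2 t1 tL; set u : R := #|U|%:R in t1 tL *; set t := p * u in t1 tL.
have p0 : 0 < p by rewrite pE expR_gt0.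
have p1 : p <= 1 by rewrite pE expR_le1; lra.
have u1 : 1024 <= u.
  have : 0 <= u by apply: ler0n.
  by move: t1; rewrite /t => t1 u0; nra.
have u0 : 0 < u by lra.
pose s := ln u; have sE : expR s = u by rewrite lnK ?posrE.
have tE : t = expR (s - l) by rewrite expRD sE -pE mulrC.
have sl : 0 <= s - l by rewrite -ler_expR expR0 -tE; lra.
have sl2 : (s - l) ^+ 2 <= 4 * t.
  have := expR_ge_sqr sl; rewrite -tE; move: sl; move: (s - l) => x.
  by rewrite !expr2; clear; nra.
have s0 : 0 <= s by lra.
have l0 : 0 < l by lra.
(* The least k allowed by thick_weight_le_expR, up to rounding. As l <= s,
   rounding costs at most a factor 3 / 2. *)
pose k := (Num.truncn (2 * s / l)).+1.
have /andP[k1 k2] : (Num.truncn (2 * s / l))%:R <= 2 * s / l < k%:R.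
  by apply: truncn_itv; rewrite divr_ge0 ?mulr_ge0 // ltW.
have ks : 2 * s <= k%:R * l by rewrite -ler_pdivrMr // ltW.
have kl : k%:R * l <= 3 * s.
  have : (Num.truncn (2 * s / l))%:R * l <= 2 * s by rewrite -ler_pdivlMr.
  by rewrite /k -natr1; lra.
pose M : R := 'C(#|U|, 2)%:R.
have M2 : u ^+ 2 <= 4 * M.
  have : 2 * M = u * (u - 1).
    rewrite /M -natrM -mul_bin_diag bin1 natrM -/u; congr (u * _).
    by rewrite -subn1 natrB // -(ltr0n R).
  by rewrite expr2; nra.
have ptu : t * u / 16 <= p * M / 4.
  have : p * u ^+ 2 <= p * (4 * M) by rewrite ler_wpM2l // ltW.
  by rewrite /t expr2; lra.
pose mu := expR (3 + (2 * k)%:R * s + t).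
have X0 : 0 <= 3 + (2 * k)%:R * s + t.
  by rewrite addr_ge0 ?addr_ge0 ?mulr_ge0 //; lra.
have mu1 : 1 <= mu by rewrite -[leLHS]expR0 ler_expR.
have ar := exponent_arith l128 sl sl2 kl t1 tL.
apply: le_trans (prob_thick_decomposable U (ltW l0) pE erefl mu1) _.
have half : expR (- (u * L)) <= 2^-1.
  rewrite expRN lef_pV2 ?posrE ?expR_gt0 //.
  have := expR_ge1Dx (u * L); have : 1 <= u * L by nra.
  lra.
apply: (@le_trans _ _ (expR (- (2 * (u * L))) + expR (- (2 * (u * L))))).
  rewrite -/M; apply: lerD; first by rewrite ler_expR; nra.
  apply: (@le_trans _ _ (expR (- (l / 2 * (p * M / 4))) * (mu ^+ #|U| * expR 1))).
    rewrite ler_wpM2l ?expR_ge0 // ler_wpM2l ?exprn_ge0 ?expR_ge0 // ler_expR.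
    rewrite ler_pdivrMr ?expR_gt0 // mul1r.
    by apply: (thick_weight_le_expR (ltW l0) s0 sE _ ks); rewrite /t pE.
  rewrite -expRM_natl -!expRD ler_expR -/u natrM.
  have : l / 2 * (t * u / 16) <= l / 2 * (p * M / 4) by rewrite ler_wpM2l // ltW // divr_gt0.
  have := ler_wpM2r (ltW u0) ar.
  lra.
rewrite (_ : - (2 * _) = - (u * L) + - (u * L)); last by ring.
rewrite expRD; move: half; have := expR_ge0 (- (u * L)).
move: (expR _) => e; clear; nra.
Qed.
End Numeric.

(** * The two tails of tau *)

Section Tails.
Variables (R : realType) (n : nat).

Lemma thick_decomposable_of_tau (G : sgraph 'I_n) (u0 : R) :
  0 <= u0 -> (tau G)%:R < n%:R - u0 ->
  exists2 U : {set 'I_n}, u0 < #|U|%:R & thick_decomposable G U.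
Proof.
move=> u00 small; have [P /andP[partP /forall_inP bP] cP] := tau_attained G.
have indT : induced_edges G setT = edges G by apply/setP => e; rewrite inE subsetT andbT.
case/and3P: partP => /eqP cE tP _; rewrite -indT in cE.
have [U [F [tF cF bF]]] := remove_stars tP cE bP.
rewrite setCT cards0 addn0 cP => leFU.
have UUC : (#|U| + #|~: U|)%N = n by rewrite cardsC card_ord.
exists U.
  have : (#|~: U| <= tau G)%N by lia.
  rewrite -(ler_nat R); move: (congr1 (fun m => m%:R : R) UUC); rewrite natrD; lra.
have tau_n : (tau G <= n)%N by rewrite -(ler_nat R); lra.
apply/existsP; exists F; apply/and4P; split; first exact: tF.
- by rewrite cF.
- by apply/subsetP => f /bF; rewrite inE.
- by lia.
Qed.

(** In the union bound, the restriction #|U| > u0 is paid for by the factor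
    exp (#|U| - u0), so that the sum over all sets of vertices is a binomial
    expansion: exp (- u0) (1 + e / (n p))^n <= exp (- u0 + e / p). *)
Lemma prob_tau_small (l p L u0 : R) :
  128 <= l -> p = expR (- l) -> 2^-1 <= L -> n%:R * p = expR L ->
  1024 <= p * u0 -> 1024 * L <= p * u0 ->
  Gnp_prob p (fun G : sgraph 'I_n => (tau G)%:R < n%:R - u0) <= n%:R^-1.
Proof.
move=> l128 pE L2 npE u0p u0L.
have p0 : 0 < p by rewrite pE expR_gt0.
have p1 : p <= 1 by rewrite pE expR_le1; lra.
have p01 : 0 <= p <= 1 by rewrite (ltW p0).
have u00 : 0 <= u0 by rewrite -(pmulr_rge0 _ p0); lra.
have n0 : 0 < n%:R :> R by rewrite -(pmulr_lgt0 _ p0) npE expR_gt0.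
pose large := [pred U : {set 'I_n} | u0 < #|U|%:R].
apply: (@le_trans _ _ (\sum_(U | large U) Gnp_prob p (fun G => thick_decomposable G U))).
  apply: Gnp_prob_union => // G /(thick_decomposable_of_tau u00)[U]; by exists U.
apply: (@le_trans _ _ (\sum_(U : {set 'I_n} | large U) expR (- u0) * expR (1 - L) ^+ #|U|)).
  apply: ler_sum => U lU; have pU : p * u0 <= p * #|U|%:R by rewrite ler_wpM2l // ltW.
  apply: le_trans (@prob_thick_le R n U l p L _ _ _ _ _) _ => //; try lra.
  rewrite -expRM_natl -expRD ler_expR; move: lU; rewrite /large /=; lra.
apply: (@le_trans _ _ (expR (- u0) * (1 + expR (1 - L)) ^+ n)).
  have -> : (1 + expR (1 - L)) ^+ n = (1 + expR (1 - L)) ^+ #|[set: 'I_n]|.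
    by rewrite cardsT card_ord.
  rewrite -sum_subsets_exp mulr_sumr [leRHS](bigID large) /= -[leLHS]addr0.
  apply: lerD; last by apply: sumr_ge0 => U _; rewrite mulr_ge0 ?exprn_ge0 ?expR_ge0.
  by rewrite [leRHS](eq_bigl large) // => U; rewrite subsetT.
have e4 : expR 1 <= 4 :> R.
  rewrite (_ : 1 = 2^-1 + 2^-1); last by field.
  have : expR 2^-1 <= 2 :> R.
    rewrite -[2^-1]opprK expRN -[leRHS]invrK lef_pV2 ?posrE ?expR_gt0 ?invr_gt0 //.
    by have := expR_ge1Dx (- 2^-1 : R); lra.
  have := expR_ge0 (2^-1 : R); rewrite expRD; move: (expR _) => e; clear; nra.
have ip : n%:R * expR (- L) = expR l.
  by rewrite expRN -npE invfM mulrA divff ?mul1r ?gt_eqF // pE expRN invrK.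
have lp : expR l * p = 1 by rewrite pE -expRD subrr expR0.
apply: (@le_trans _ _ (expR (- u0) * expR (4 * expR l))).
  rewrite ler_wpM2l ?expR_ge0 // add1_expn_le ?expR_ge0 // addrC expRD mulrA ip.
  by rewrite mulrC ler_wpM2r ?expR_ge0.
have nE : n%:R = expR (L + l) by rewrite expRD -npE -mulrA [p * _]mulrC lp mulr1.
rewrite nE -expRN -expRD ler_expR.
have uE : expR l * (p * u0) = u0 by rewrite mulrA lp mul1r.
have el : 1 + l <= expR l := expR_ge1Dx l.
have h1 : expR l * 1024 <= u0 by rewrite -[leRHS]uE ler_wpM2l ?expR_ge0.
have h2 : expR l * (1024 * L) <= u0 by rewrite -[leRHS]uE ler_wpM2l ?expR_ge0.
have h3 : L <= expR l * L by rewrite ler_peMl; lra.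
lra.
Qed.

(** The number of sets of fewer than K vertices is bounded by x^(- K) (1 + x)^n
    with x = exp (- eta); eta is chosen such that x <= w / 8, where
    w = (n p)^(- 1 / 4) is a lower bound on (1 - p)^K. *)
Lemma prob_tau_large (p L : R) :
  0 < p <= 2^-1 -> 2^-1 <= L -> n%:R * p = expR L ->
  Gnp_prob p (fun G : sgraph 'I_n => n%:R - L / p / 128 < (tau G)%:R) <= 64 / n%:R.
Proof.
move=> /andP[p0 p2] L2 npE; set K := L / p / 128.
have p01 : 0 <= p <= 1 by lra.
have n0 : 0 < n%:R :> R by rewrite -(pmulr_lgt0 _ p0) npE expR_gt0.
have pK : p * K = L / 128 by rewrite /K; field; lra.
have eL : 1 + L <= expR L := expR_ge1Dx L.
have Kn : K <= n%:R / 2.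
  rewrite -(ler_pM2l p0) pK mulrA [p * _]mulrC npE; lra.
pose w := expR (- (L / 4)); have w0 : 0 < w by apply: expR_gt0.
pose small := [pred I : {set 'I_n} | #|I|%:R < K].
apply: (@le_trans _ _ (\sum_(I | small I) Gnp_prob p (fun G => dominating G I))).
  apply: Gnp_prob_union => // G tauG.
  have [I /andP[indI domI]] := exists_independent_dominating G.
  exists I => //; have := tau_le_independent indI.
  have : (#|I| + #|~: I|)%N = n by rewrite cardsC card_ord.
  move=> /(congr1 (fun m => m%:R : R)); rewrite natrD -(ler_nat R) /small /=; lra.
pose eta := 3 + L / 4; have eta0 : 0 <= eta by rewrite /eta; lra.
have dom I : small I -> Gnp_prob p (fun G => dominating G I) <= expR (- (w * n%:R / 2)).
  rewrite /small /= => IK; rewrite Gnp_prob_dominating.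
  have cI : #|~: I|%:R = n%:R - #|I|%:R :> R.
    have := congr1 (fun m => m%:R : R) (cardsC I); rewrite card_ord natrD => <-.
    by rewrite [RHS]addrC addKr.
  have wI : w <= (1 - p) ^+ #|I|.
    have -> : w = expR (- (L / 4)) by [].
    apply: (@le_trans _ _ (expR (- (2 * p)) ^+ #|I|)).
      rewrite -expRM_natl ler_expR mulrN lerN2.
      have : #|I|%:R * p <= K * p by rewrite ler_wpM2r // ltW.
      rewrite [K * p]mulrC pK; lra.
    apply: le_expr; rewrite ?expR_ge0 // expRN -[leRHS]invrK.
    rewrite lef_pV2 ?posrE ?expR_gt0 ?invr_gt0 //; last by lra.
    apply: le_trans (expR_ge1Dx _); rewrite -[leLHS]mul1r ler_pdivrMr; last by lra.
    nra.
  apply: (@le_trans _ _ (expR (- w) ^+ #|~: I|)).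
    apply: le_expr; first by rewrite subr_ge0 exprn_ile1; lra.
    by have := expR_ge1Dx (- w); lra.
  rewrite -expRM_natl ler_expR cI mulrN lerN2 -mulrA mulrC ler_wpM2r ?(ltW w0) //.
  lra.
apply: (@le_trans _ _ (\sum_(I : {set 'I_n} | small I) expR (- (w * n%:R / 2)) * (expR (eta * K) * expR (- eta) ^+ #|I|))).
  apply: ler_sum => I sI; apply: (le_trans (dom I sI)).
  rewrite ler_peMr ?expR_ge0 // -expRM_natl -expRD -[leLHS]expR0 ler_expR.
  rewrite mulrN [_%:R * eta]mulrC -mulrBr mulr_ge0 // subr_ge0.
  exact: ltW.
apply: (@le_trans _ _ (expR (- (w * n%:R / 2)) * (expR (eta * K) * (1 + expR (- eta)) ^+ n))).
  have -> : (1 + expR (- eta)) ^+ n = (1 + expR (- eta)) ^+ #|[set: 'I_n]|.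
    by rewrite cardsT card_ord.
  rewrite -sum_subsets_exp !mulr_sumr [leRHS](bigID small) /= -[leLHS]addr0.
  apply: lerD; last by apply: sumr_ge0 => U _; rewrite !mulr_ge0 ?exprn_ge0 ?expR_ge0.
  by rewrite [leRHS](eq_bigl small) // => U; rewrite subsetT.
have etaw : expR (- eta) <= w / 8.
  rewrite /eta opprD expRD mulrC ler_wpM2l ?(ltW w0) // expRN lef_pV2 ?posrE ?expR_gt0 //.
  have := @expR_ge_sqr R 3; have := expR_ge1Dx (1 : R).
  rewrite (_ : 3 = 1 + (1 + 1)); last by ring.
  rewrite !expRD => e1 _; have : 2 <= expR 1 :> R by lra.
  move: (expR 1) => e; clear; nra.
have wnE : w * n%:R = expR (L * 3 / 4) / p.
  have -> : n%:R = expR L / p by rewrite -npE mulfK ?gt_eqF.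
  by rewrite mulrA -expRD; congr (expR _ / _); field.
have etaK : eta * K <= w * n%:R / 8.
  rewrite -(ler_pM2r p0) -[eta * K * p]mulrA [K * p]mulrC pK wnE.
  rewrite [_ / 8 * p]mulrAC divfK ?gt_eqF //.
  have := @expR_ge_sqr R (L * 3 / 4); have : 0 <= L * 3 / 4 by lra.
  move=> L34 /(_ L34); rewrite /eta expr2; nra.
(* As n p <= n, w n is even at least n^(3 / 4). *)
have wn2 : n%:R <= (w * n%:R) ^+ 2.
  have : expR (L / 2) <= n%:R.
    apply: (@le_trans _ _ (expR L)); first by rewrite ler_expR; lra.
    by rewrite -npE ler_piMr; lra.
  have : w ^+ 2 * expR (L / 2) = 1.
    by rewrite -expRM_natl -expRD -[RHS]expR0; congr expR; field.
  rewrite exprMn; move: (expR _) => a; have : 0 <= w ^+ 2 by rewrite sqr_ge0.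
  move: (w ^+ 2) => b b0 ba an; rewrite expr2 mulrA ler_peMl ?(ltW n0) //.
  by rewrite -[leLHS]ba ler_wpM2l.
apply: (@le_trans _ _ (expR (- (w * n%:R / 4)))).
  apply: (@le_trans _ _ (expR (- (w * n%:R / 2)) * (expR (eta * K) * expR (w * n%:R / 8)))).
    rewrite ler_wpM2l ?expR_ge0 // ler_wpM2l ?expR_ge0 // add1_expn_le ?expR_ge0 //.
    have := ler_wpM2l (ltW n0) etaw; lra.
  rewrite -!expRD ler_expR; lra.
have y0 : 0 <= w * n%:R / 4 by rewrite divr_ge0 // mulr_ge0 // ltW.
rewrite expRN ler_pdivlMr // [leLHS]mulrC ler_pdivrMr ?expR_gt0 //.
have := expR_ge_sqr y0.
move: wn2 y0; move: (w * n%:R) (expR _) => y e; rewrite !expr2; clear; nra.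
Qed.

End Tails.

(** * The theorem *)

Section Final.
Variables (R : realType).

Lemma prob_tau_between n (p : R) : (0 < n)%N -> 2 / n%:R <= p <= expR (- 128) ->
  1 - 65 / n%:R <= Gnp_prob p (fun G : sgraph 'I_n =>
    n%:R - 1024 * (log2 (n%:R * p) / p) <= (tau G)%:R
      <= n%:R - ln 2 / 128 * (log2 (n%:R * p) / p)) <= 1.
Proof.
move=> n0 /andP[pn pc].
have n0' : 0 < n%:R :> R by rewrite ltr0n.
have p0 : 0 < p by apply: lt_le_trans pn; rewrite divr_gt0.
have ph : p <= 2^-1.
  apply: (le_trans pc); rewrite expRN lef_pV2 ?posrE ?expR_gt0 //.
  by have := expR_ge1Dx (128 : R); lra.
have p01 : 0 <= p <= 1 by lra.
apply/andP; split; last first.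
  by rewrite -[leRHS](Gnp_prob_total n p); apply: le_Gnp_prob.
have np2 : 2 <= n%:R * p by rewrite mulrC -ler_pdivrMr.
have np0 : 0 < n%:R * p by rewrite mulr_gt0.
pose L := ln (n%:R * p); have LE : n%:R * p = expR L by rewrite lnK ?posrE.
have /andP[ln2l ln2u] := ln2_bounds R.
have ln2L : ln 2 <= L by rewrite ler_ln ?posrE.
have l128 : 128 <= - ln p by rewrite lerNr -ler_expR lnK ?posrE.
have pE : p = expR (- - ln p) by rewrite opprK lnK ?posrE.
have ln20 : ln 2 != 0 :> R by apply: lt0r_neq0; lra.
have log_ge x : x * ln 2 <= L -> x <= log2 (n%:R * p).
  by move=> xL; rewrite /log2 ler_pdivlMr //; lra.
have log1 : 1 <= log2 (n%:R * p) by apply: log_ge; rewrite mul1r.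
have logL : L <= log2 (n%:R * p) by apply: log_ge; rewrite ler_piMr; lra.
have E2 : ln 2 / 128 * (log2 (n%:R * p) / p) = L / p / 128.
  by rewrite /log2 -/L; field; rewrite ln20 gt_eqF.
have E1 : p * (1024 * (log2 (n%:R * p) / p)) = 1024 * log2 (n%:R * p).
  by field; rewrite gt_eqF.
rewrite Gnp_prob_compl E2.
set u0 := 1024 * _ in E1 *.
have L2 : 2^-1 <= L by apply: le_trans ln2L.
have pu1 : 1024 <= p * u0 by lra.
have puL : 1024 * L <= p * u0 by lra.
have p0h : 0 < p <= 2^-1 by rewrite p0.
have -> : 65 / n%:R = n%:R^-1 + 64 / n%:R :> R by field; rewrite gt_eqF.
rewrite lerD2l lerN2.
apply: le_trans (lerD (prob_tau_small l128 pE L2 LE pu1 puL) (prob_tau_large p0h L2 LE)).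
by apply: Gnp_prob_cup => [//|G]; rewrite negb_and -!ltNge.
Qed.

End Final.

From mathcomp Require Import all_classical all_reals all_analysis.

Import numFieldNormedType.Exports.

Local Open Scope classical_set_scope.

Theorem theorem1p2 (R : realType) :
  exists c C1 C2 : R,
    [/\ 0 < c, 0 < C1, 0 < C2 &
      forall p : nat -> R,
        (forall n, 0 <= p n <= 1) ->
        (\forall n \near \oo, 2 / n%:R <= p n <= c) ->
        (fun n : nat =>
           Gnp_prob (p n) (fun G : sgraph 'I_n =>
             n%:R - C2 * (log2 (n%:R * p n) / p n) <= (tau G)%:R
               <= n%:R - C1 * (log2 (n%:R * p n) / p n)))
          @ \oo --> (1 : R)].
Proof.
exists (expR (- 128)), (ln 2 / 128), 1024.
have /andP[ln2l _] := ln2_bounds R.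
split=> [|||p _ pc]; [exact: expR_gt0|lra|by rewrite ltr0n|].
have lim1 : (fun n : nat => 1 - 65 / n%:R : R) @ \oo --> (1 : R).
  rewrite -[X in _ --> X]subr0 -[X in _ - X](mulr0 65).
  apply: cvgB; first exact: cvg_cst.
  apply: cvgM; first exact: cvg_cst.
  rewrite -(cvg_shiftn 1) /=.
  under eq_fun do rewrite addn1.
  exact: cvg_harmonic.
apply: (@squeeze_cvgr _ _ _ _ (fun n : nat => 1 - 65 / n%:R) (fun=> 1)); [|exact: lim1|exact: cvg_cst].
near=> n; apply: prob_tau_between.
  by near: n; exact: nbhs_infty_gt.
by near: n.
Unshelve. all: by end_near.
Qed.
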